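(* Let $\Gamma$ be a torsion-free hyperbolic group, let $T_1$ and $T_2$ be simplicial trees of bounded valence, and let $\rho\colon\Gamma\to\mathrm{Aut}(T_1\times T_2)$ be a discrete faithful representation such that $\rho(\Gamma)$ preserves both trees, i.e. $\rho(\Gamma)\subset \mathrm{Aut}(T_1)\times\mathrm{Aut}(T_2)$. Let $\rho_i\colon\Gamma\to\mathrm{Aut}(T_i)$, $i=1,2$, be the induced representations. Then either $\Gamma$ is free, or both $\rho_1$ and $\rho_2$ are faithful and indiscrete.
   Context: Hyperbolic means Gromov hyperbolic (in particular finitely generated). Automorphism groups of trees and of their products carry the usual topology (compact-open, equivalently pointwise convergence on vertices). A representation is faithful if it is injective, discrete if its image is a discrete subgroup, and indiscrete if its image is not a discrete subgroup. *)

(* Defs.v *)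
From HB Require Import structures.
From mathcomp Require Import all_boot all_order all_algebra.
From mathcomp Require Import all_classical.
From mathcomp Require Import topology function_spaces.

Set Implicit Arguments.
Unset Strict Implicit.
Unset Printing Implicit Defensive.

Import Order.TTheory GRing.Theory Num.Theory.

Local Open Scope classical_set_scope.
Local Open Scope card_scope.
Local Open Scope group_scope.

Section Groups.
Variable G : groupType.

Definition torsion_free : Prop :=
  forall (g : G) (n : nat), (0 < n)%N -> g ^+ n = 1 -> g = 1.

Definition is_word (S w : seq G) : bool :=
  all (fun x => (x \in S) || (x^-1 \in S)) w.

Definition generates (S : seq G) : Prop :=
  forall g : G, exists w, is_word S w /\ \prod_(x <- w) x = g.

(* The junk value 0 is taken only at elements outside the subgroup generated
   by S. *)
Definition word_norm (S : seq G) (g : G) : nat :=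
  let lengths := [set n | exists w,
    [/\ is_word S w, size w = n & \prod_(x <- w) x = g]] in
  xget 0%N [set n | lengths n /\ forall m, lengths m -> (n <= m)%N].

Definition word_dist (S : seq G) (x y : G) : nat := word_norm S (x^-1 * y).

Definition gromov_product (d : G -> G -> nat) (w x y : G) : rat :=
  (((d x w)%:R + (d y w)%:R - (d x y)%:R) / 2%:R)%R.

(* Gromov's four-point condition, for a metric d. *)
Definition gromov_hyperbolic (d : G -> G -> nat) : Prop :=
  exists delta : rat, forall w x y z : G,
    (Order.min (gromov_product d w x y) (gromov_product d w y z) - delta
       <= gromov_product d w x z)%R.

Definition hyperbolic_group : Prop :=
  exists S : seq G, generates S /\ gromov_hyperbolic (word_dist S).

(* The letter (x, true) stands for x, the letter (x, false) for x^-1. *)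
Definition letter_val (l : G * bool) : G := if l.2 then l.1 else l.1^-1.

Definition reduced_word (w : seq (G * bool)) : bool :=
  sorted (fun l l' => ~~ ((l.1 == l'.1) && (l.2 != l'.2))) w.

Definition is_basis (X : set G) : Prop :=
  forall g : G, exists! w : seq (G * bool),
    [/\ forall l, l \in w -> X l.1, reduced_word w
      & \prod_(l <- w) letter_val l = g].

(* The rank is arbitrary; the empty basis makes the trivial group free. *)
Definition free_group : Prop := exists X : set G, is_basis X.

End Groups.

(* A cell complex in which a cell is determined by its set of vertices is
   encoded by its vertex type V and the family K of vertex sets of its cells. *)
Section Automorphisms.
Variables (V : choiceType) (K : set (set V)).

Record aut := Aut {
  aut_fun :> V -> V;
  aut_inv : V -> V;
  aut_funK : cancel aut_fun aut_inv;
  aut_invK : cancel aut_inv aut_fun;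
  aut_cell : forall A : set V, K (aut_fun @` A) <-> K A
}.

Lemma aut_ext (a b : aut) : aut_fun a = aut_fun b -> a = b.
Proof.
case: a => f f' fK f'K fc; case: b => g g' gK g'K gc /= fg; subst g.
have fg' : f' = g' by apply/funext => x; rewrite -{1}[x]g'K fK.
by subst g'; congr Aut; exact: Prop_irrelevance.
Qed.

HB.instance Definition _ := gen_eqMixin aut.
HB.instance Definition _ := gen_choiceMixin aut.

Lemma aut_one_cell (A : set V) : K (idfun @` A) <-> K A.
Proof. by rewrite image_id. Qed.

Definition aut_one : aut :=
  @Aut idfun idfun (fun=> erefl) (fun=> erefl) aut_one_cell.

Lemma aut_mul_cell (a b : aut) (A : set V) : K ((a \o b) @` A) <-> K A.
Proof. by rewrite -image_comp !aut_cell. Qed.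

Definition aut_mul (a b : aut) : aut :=
  @Aut (a \o b) (aut_inv b \o aut_inv a)
    (can_comp (@aut_funK a) (@aut_funK b))
    (can_comp (@aut_invK b) (@aut_invK a)) (aut_mul_cell a b).

Lemma aut_inv_cell (a : aut) (A : set V) : K (aut_inv a @` A) <-> K A.
Proof.
rewrite -(aut_cell a) image_comp (_ : a \o aut_inv a = id) ?image_id//.
by apply/funext => x /=; rewrite aut_invK.
Qed.

Definition aut_invg (a : aut) : aut :=
  @Aut (aut_inv a) a (@aut_invK a) (@aut_funK a) (aut_inv_cell a).

Lemma aut_mulA : associative aut_mul.
Proof. by move=> a b c; exact: aut_ext. Qed.

Lemma aut_mul1 : left_id aut_one aut_mul.
Proof. by move=> a; exact: aut_ext. Qed.

Lemma aut_mulr1 : right_id aut_one aut_mul.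
Proof. by move=> a; exact: aut_ext. Qed.

Lemma aut_mulV : left_inverse aut_one aut_invg aut_mul.
Proof. by move=> a; apply: aut_ext; apply/funext => x; exact: aut_funK. Qed.

Lemma aut_mulrV : right_inverse aut_one aut_invg aut_mul.
Proof. by move=> a; apply: aut_ext; apply/funext => x; exact: aut_invK. Qed.

HB.instance Definition _ :=
  isGroup.Build aut aut_mulA aut_mul1 aut_mulr1 aut_mulV aut_mulrV.

(* Pointwise convergence on the discrete set of vertices. *)
HB.instance Definition _ := Topological.copy aut
  (initial_topology (aut_fun : aut -> {ptws V -> discrete_topology V})).

End Automorphisms.

(* A subset is discrete when each of its points is isolated in it. *)
Definition discrete_rep (G : Type) (H : topologicalType) (rho : G -> H) : Prop :=
  range rho `<=` isolated (range rho).

Record tree := Tree {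
  vertex :> choiceType;
  adj : rel vertex;
  adj_sym : symmetric adj;
  adj_irr : irreflexive adj;
  tree_nonempty : exists v : vertex, True;
  tree_connected : forall x y : vertex,
    exists2 p : seq vertex, path adj x p & last x p = y;
  tree_acyclic : forall c : seq vertex, (2 < size c)%N -> ~~ ucycleb adj c
}.

Definition bounded_valence (T : tree) : Prop :=
  exists N : nat, forall v : T, [set w | adj v w] #<= `I_N.

Definition tree_cells (T : tree) : set (set T) :=
  [set A | (exists v, A = [set v]) \/
           (exists v w, adj v w /\ A = [set v; w])].
Arguments tree_cells T : clear implicits.

Definition prod_cells (V1 V2 : choiceType) (K1 : set (set V1))
    (K2 : set (set V2)) : set (set (V1 * V2)) :=
  [set C | exists A B, [/\ K1 A, K2 B & C = A `*` B]].

Notation tree_aut T := (aut (tree_cells T)).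
Notation prod_tree_aut T1 T2 :=
  (aut (prod_cells (tree_cells T1) (tree_cells T2))).

Section ProductAutomorphism.
Variables (V1 V2 : choiceType) (K1 : set (set V1)) (K2 : set (set V2)).
Variables (a : aut K1) (b : aut K2).

Let f (p : V1 * V2) := (a p.1, b p.2).
Let f' (p : V1 * V2) := (aut_inv a p.1, aut_inv b p.2).

Let fK : cancel f f'.
Proof. by case=> x y; rewrite /f /f' /= !aut_funK. Qed.

Let f'K : cancel f' f.
Proof. by case=> x y; rewrite /f /f' /= !aut_invK. Qed.

Let image_f A B : f @` (A `*` B) = (a @` A) `*` (b @` B).
Proof.
apply/seteqP; split=> [_ [[x y] [/= Ax By] <-]|[_ _] [/= [x Ax <-] [y By <-]]].
  by split; [exists x | exists y].
by exists (x, y).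
Qed.

Let image_f' A B : f' @` (A `*` B) = (aut_inv a @` A) `*` (aut_inv b @` B).
Proof.
apply/seteqP; split=> [_ [[x y] [/= Ax By] <-]|[_ _] [/= [x Ax <-] [y By <-]]].
  by split; [exists x | exists y].
by exists (x, y).
Qed.

Let f_cell C : prod_cells K1 K2 (f @` C) <-> prod_cells K1 K2 C.
Proof.
split=> [[A [B [KA KB fC]]]|[A [B [KA KB ->]]]].
  exists (aut_inv a @` A), (aut_inv b @` B); split.
  - exact/(aut_inv_cell a).
  - exact/(aut_inv_cell b).
  - rewrite -image_f' -fC image_comp (_ : f' \o f = id) ?image_id//.
    by apply/funext => p; exact: fK.
exists (a @` A), (b @` B); split; last exact: image_f.
- exact/aut_cell.
- exact/aut_cell.
Qed.

Definition aut_prod : aut (prod_cells K1 K2) := Aut fK f'K f_cell.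

End ProductAutomorphism.

(* Main.v *)
Require Import Defs.
From mathcomp Require Import all_boot all_order all_algebra all_classical.
From mathcomp Require Import topology function_spaces.
From mathcomp Require Import zify lra.

(** Write [G] for the group. Discreteness means that some finite set of
    vertices of the product has trivial pointwise stabiliser. In a tree of
    bounded valence, an element that fixes one vertex permutes the finitely many
    neighbours of that vertex, so any other vertex is fixed by a positive power
    of it. Hence an element that fixes a vertex in both trees has a power that
    fixes the finite set above; that power is trivial, and so is the element,
    [G] being torsion-free. So [G] acts freely on pairs of vertices.

    If one factor action is faithful and discrete, the same argument shows
    that it is free on vertices, and a torsion-free group acting freely on the
    vertices of a tree is free. It remains to show that [G] is free when one of
    the factor actions, say the first, kills some [h <> 1]
    ([free_of_kernel]). The kernel of the first action acts freely on the second
    tree. Let [g] fix a vertex [v] of the second tree; some power [a = g ^+ n]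
    with [n > 0] fixes [h v] too. The commutator of [a] and [h] lies in the
    kernel and fixes a vertex, so [a] and [h] commute. A hyperbolic group
    contains no free abelian group of rank two, so there is a nontrivial
    relation between [a] and [h]; applying it to [v], which [a] fixes and no
    nontrivial power of [h] fixes, shows that it is a relation between powers
    of [a] alone. Thus [a = 1] and [g = 1]: the second action is free.

    Two classical facts carry the argument. The first is
    [hyperbolic_commute_dependent], the absence of rank two free abelian
    subgroups. Let [x] be a long element that commutes with [a] and [b]. The
    translates of a geodesic from [1] to [x] by the [a ^+ i * b ^+ j] with
    [i, j < M] have endpoints close to [1] and to [x]; away from these ends
    they stay within a distance of the geodesic that does not depend on [M].
    If these [M ^ 2] elements were distinct, they would move a given point of
    the geodesic to [M ^ 2] distinct points close to a segment of it whose
    length is linear in [M], which is impossible for large [M].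

    The second is [free_of_free_tree_action]. A maximal connected set [D] of
    vertices that meets each orbit at most once meets each orbit. The elements
    that carry [D] to a set adjacent to [D] generate the group, and they play
    ping-pong with the half-trees cut off by the edges that leave [D]
    ([ping_pong_free]). *)

Set Implicit Arguments.
Unset Strict Implicit.
Unset Printing Implicit Defensive.
Import Order.TTheory GRing.Theory Num.Theory.
Local Open Scope classical_set_scope.
Local Open Scope group_scope.

(** * Commuting elements of hyperbolic groups *)

(** Clearing denominators in the inequality between Gromov products turns it
    into a comparison of the three ways to pair off four points, with an error
    [D] that bounds twice the hyperbolicity constant. *)
Lemma four_point (G : groupType) (d : G -> G -> nat) : gromov_hyperbolic d ->
  exists D : nat, forall w x y z : G,
   (d x z + d y w <= maxn (d x y + d z w) (d y z + d x w) + D)%N.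
Proof.
move=> [delta hyp]; exists (Num.bound (2%:R * `|delta|))%R => w x y z.
set D := Num.bound _.
have HD : (2%:R * `|delta| < D%:R)%R by apply: archi_boundP; rewrite mulr_ge0.
have Hd : (delta <= `|delta|)%R by exact: ler_norm.
rewrite addn_maxl leq_max -!(ler_nat rat) !natrD.
have := hyp w x y z; rewrite /gromov_product lerBlDr ge_min.
move=> /orP[H|H]; apply/orP; [left|right]; move: H HD Hd; lra.
Qed.

Section WordMetric.
Variables (G : groupType) (S : seq G).
Hypothesis genS : generates S.
Local Notation norm := (word_norm S).
Local Notation d := (word_dist S).

Lemma is_word_cat v w : is_word S (v ++ w) = is_word S v && is_word S w.
Proof. exact: all_cat. Qed.

Lemma word_normP g : exists w,
  [/\ is_word S w, size w = norm g & \prod_(x <- w) x = g].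
Proof.
rewrite /word_norm; set A := (X in xget _ X).
suff [n An] : exists n, A n by case: (@xgetPex _ 0%N A (ex_intro _ n An)).
have [w0 [Sw0 w0g]] := genS g.
pose L n := exists w, [/\ is_word S w, size w = n & \prod_(x <- w) x = g].
have exL : exists n, `[< L n >] by exists (size w0); apply/asboolP; exists w0.
case: (ex_minnP exL) => n /asboolP Ln nmin; exists n; split=> // m Lm.
by apply: nmin; apply/asboolP.
Qed.

Lemma word_norm_le w : is_word S w -> (norm (\prod_(x <- w) x) <= size w)%N.
Proof.
move=> Sw; set g := \prod_(x <- w) x.
rewrite /word_norm; case: xgetP => [n -> [_ nmin]|] //.
by apply: nmin; exists w.
Qed.

Lemma word_norm1 : norm 1 = 0%N.
Proof. by have := @word_norm_le [::] isT; rewrite big_nil leqn0 => /eqP. Qed.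

Lemma word_normM g h : (norm (g * h) <= norm g + norm h)%N.
Proof.
have [v [Sv <- <-]] := word_normP g; have [w [Sw <- <-]] := word_normP h.
by rewrite -big_cat -size_cat word_norm_le // is_word_cat Sv.
Qed.

Lemma word_normV g : norm g^-1 = norm g.
Proof.
suff le h : (norm h^-1 <= norm h)%N.
  by apply/eqP; rewrite eqn_leq le -{1}[g]invgK le.
have [w [Sw <- <-]] := word_normP h.
rewrite -[w in \prod_(x <- w) x]revK -prodgV -(big_map _ predT id).
rewrite -size_rev -(size_map (fun x : G => x^-1)) word_norm_le //.
rewrite /is_word all_map all_rev; apply: sub_all Sw => x /=.
by rewrite invgK orbC.
Qed.

Lemma word_normX g n : (norm (g ^+ n) <= n * norm g)%N.
Proof.
elim: n => [|n IH]; first by rewrite word_norm1.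
rewrite expgS mulSn; exact: leq_trans (word_normM _ _) (leq_add _ IH).
Qed.

Lemma word_geodesic g t : (t <= norm g)%N -> exists p,
  [/\ norm p = t & (norm (p^-1 * g) = norm g - t)%N].
Proof.
move=> tg; have [w [Sw sw wg]] := word_normP g.
have := Sw; rewrite -(cat_take_drop t w) is_word_cat => /andP[Sv Su].
pose p := \prod_(x <- take t w) x; pose q := \prod_(x <- drop t w) x.
have pq : p * q = g by rewrite -big_cat cat_take_drop.
exists p; rewrite -pq mulKg pq.
have := word_normM p q; rewrite pq.
have := word_norm_le Sv; have := word_norm_le Su; rewrite -/p -/q.
rewrite size_takel ?size_drop sw //; lia.
Qed.

Lemma word_ball_finite k :
  exists B : seq G, forall g, (norm g <= k)%N -> g \in B.
Proof.
suff [B BP] : exists B : seq G, forall w, is_word S w -> (size w <= k)%N ->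
    \prod_(x <- w) x \in B.
  exists B => g; have [w [Sw <- <-]] := word_normP g; exact: BP.
elim: k => [|k [B BP]].
  by exists [:: 1] => -[|x w] //; rewrite big_nil inE.
exists (1 :: [seq x * y | x <- S ++ [seq x^-1 | x <- S], y <- B]) => -[|x w] /=.
  by rewrite big_nil inE eqxx.
move=> /andP[Sx Sw] kw; rewrite big_cons inE; apply/orP; right.
apply: allpairs_f; last exact: BP.
rewrite mem_cat; case/orP: Sx => [->//|Sx].
by apply/orP; right; rewrite -[x]invgK; apply: map_f.
Qed.

Lemma word_distC x y : d x y = d y x.
Proof. by rewrite /word_dist -word_normV invgM invgK. Qed.

Lemma word_distM z x y : d (z * x) (z * y) = d x y.
Proof. by rewrite /word_dist invgM -mulgA mulKg. Qed.

Lemma word_dist1 x : d 1 x = norm x.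
Proof. by rewrite /word_dist invg1 mul1g. Qed.

Lemma word_dist_trans y x z : (d x z <= d x y + d y z)%N.
Proof. by have := word_normM (x^-1 * y) (y^-1 * z); rewrite mulgA mulgK. Qed.

Lemma word_norm_unbounded (f : nat -> G) m : injective f ->
  exists k, (m < norm (f k))%N.
Proof.
move=> f_inj; apply: contrapT => bounded.
have [B BP] := word_ball_finite m.
suff : (size (mkseq f (size B).+1) <= size B)%N by rewrite size_mkseq ltnn.
apply: uniq_leq_size; first by rewrite mkseq_uniq.
move=> _ /mapP[k _ ->]; apply: BP; rewrite leqNgt.
by apply: contra_notN bounded => ?; exists k.
Qed.

(** The point [q := z * p t] lies on a geodesic from [z] to [z * x = x * z],
    whose endpoints are within [r] of [1] and of [x]. Two instances of the
    four-point inequality give [d 1 q + d q x <= norm x + 2 * D]; the bounds on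
    [t] decide which pairing attains the maximum, so that the error does not
    depend on [r]. A third instance bounds the distance from [q] to the point of
    the geodesic at distance [d 1 q] from [1]. *)
Lemma translate_near_geodesic D x (p : nat -> G) z r t :
  (forall w x y z : G,
     (d x z + d y w <= maxn (d x y + d z w) (d y z + d x w) + D)%N) ->
  (forall s, (s <= norm x)%N ->
     norm (p s) = s /\ norm ((p s)^-1 * x) = (norm x - s)%N) ->
  commute z x -> (norm z <= r)%N -> (r <= t)%N -> (t + r <= norm x)%N ->
  exists s, (s <= t + r)%N /\ (d (p s) (z * p t) <= 3 * D)%N.
Proof.
move=> hyp geo zx zr rt tx; set n := norm x in geo tx *; set q := z * p t.
have d1z : d 1 z = norm z by rewrite word_dist1.
have dxw : d x (z * x) = norm z by rewrite zx /word_dist mulKg.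
have [t1 t2] : norm (p t) = t /\ norm ((p t)^-1 * x) = (n - t)%N.
  by apply: geo; lia.
have dzq : d z q = t by rewrite -{1}[z]mulg1 word_distM word_dist1.
have dqw : d q (z * x) = (n - t)%N by rewrite word_distM.
have dzw : d z (z * x) = n by rewrite -{1}[z]mulg1 word_distM word_dist1.
have T1 := word_dist_trans z 1 q.
pose s := d 1 q.
have [s1 s2] : norm (p s) = s /\ norm ((p s)^-1 * x) = (n - s)%N.
  by apply: geo; rewrite /s; lia.
have d1s : d 1 (p s) = s by rewrite word_dist1.
have dsx : d (p s) x = (n - s)%N by [].
have d1x : d 1 x = n by rewrite word_dist1.
have T2 := word_dist_trans (z * x) 1 x.
have H1 := hyp (z * x) q z 1; have H2 := hyp (z * x) q 1 x.
have H3 := hyp x q 1 (p s).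
exists s; rewrite word_distC.
rewrite ?(word_distC q 1) ?(word_distC z 1) ?(word_distC q z)
  ?(word_distC (z * x) x) in T1 T2 H1 H2 H3.
split; first by rewrite /s; lia.
rewrite /s in H3 d1s dsx *; lia.
Qed.

End WordMetric.

(** If all the products were distinct, some power [x] of [b] would be longer
    than [2 * r], and the [M ^ 2] translates of the point at distance [r] from
    [1] on a geodesic to [x] would be among [(2 * r + 1) * size B] points,
    where [B] contains the ball of radius [3 * D] and [r] is linear in [M]. *)
Lemma hyperbolic_commute_dependent (G : groupType) (a b : G) :
  hyperbolic_group G -> commute a b ->
  exists i j i' j', (i, j) <> (i', j') /\ a ^+ i * b ^+ j = a ^+ i' * b ^+ j'.
Proof.
move=> [S [genS hyp]] ab; apply: contrapT => indep.
have inj i j i' j' :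
    a ^+ i * b ^+ j = a ^+ i' * b ^+ j' -> (i, j) = (i', j').
  move=> e; apply: contrapT => ne; apply: indep.
  by exists i, j, i', j'.
have [D hypD] := four_point hyp.
have [B BP] := word_ball_finite genS (3 * D).
(* M is chosen so that M ^ 2 exceeds (2 * r + 1) * size B. *)
pose c := (word_norm S a + word_norm S b)%N.
pose M := ((2 * c + 1) * size B).+1; pose r := (M * c)%N.
have [k xk] : exists k, (2 * r < word_norm S (b ^+ k))%N.
  apply: word_norm_unbounded => // j j' e.
  by have [] := inj 0 j 0 j' (congr1 _ e).
set x := b ^+ k in xk.
have /choice[p geo] s : exists g, (s <= word_norm S x)%N ->
    word_norm S g = s /\ word_norm S (g^-1 * x) = (word_norm S x - s)%N.
  have [le|_] := boolP (s <= word_norm S x)%N; last by exists 1.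
  by have [g [? ?]] := word_geodesic genS le; exists g.
pose zs := [seq a ^+ i * b ^+ j * p r | i <- iota 0 M, j <- iota 0 M].
pose near := [seq p s * u | s <- iota 0 (r + r).+1, u <- B].
have : (size zs <= size near)%N.
  apply: uniq_leq_size.
    apply: allpairs_uniq; rewrite ?iota_uniq // => -[i j] [i' j'] _ _ /=.
    by move=> /mulIg /inj.
  move=> z /allpairsP[[i j]]; rewrite !mem_iota => -[/= iM jM ->].
  have zr : (word_norm S (a ^+ i * b ^+ j) <= r)%N.
    apply: leq_trans (word_normM _ _ _) _ => //.
    apply: leq_trans (leq_add (word_normX _ _ _) (word_normX _ _ _)) _ => //.
    by rewrite /r /c mulnDr leq_add // leq_mul2r ltnW ?orbT.
  have xz : commute x (a ^+ i * b ^+ j).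
    by apply: commuteM; apply: commuteX2; rewrite // /commute ab.
  have [|s [sr ds]] :=
    translate_near_geodesic genS hypD geo (esym xz) zr (leqnn _).
    by lia.
  rewrite -[X in X \in _](mulVKg (p s)); apply: allpairs_f; last exact: BP.
  by rewrite mem_iota.
rewrite !size_allpairs !size_iota leqNgt => /negP; apply.
apply: (@leq_ltn_trans (M * ((2 * c + 1) * size B))%N).
  by rewrite mulnA leq_mul2r /r; apply/orP; right; nia.
by rewrite ltn_pmul2l.
Qed.

(** * Ping-pong for a symmetric generating set *)

Lemma torsion_free_inj_exp (G : groupType) (g : G) m n :
  torsion_free G -> g ^+ m = g ^+ n -> m = n \/ g = 1.
Proof.
move=> tf; wlog le_mn : m n / (m <= n)%N => [hw|] e.
  by case: (leqP m n) => [/hw|/ltnW/hw] /(_ _)[]//; [left|right|left|right].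
move: le_mn; rewrite leq_eqVlt => /orP[/eqP|lt_mn]; [by left|right].
apply: (tf _ (n - m)%N); rewrite ?subn_gt0 //.
by rewrite expgnFr ?(ltnW lt_mn) // e mulgV.
Qed.

(** The set [branch x] plays the part of the points that are reached from [o] by
    first crossing towards [x]. Unlike in the usual ping-pong lemma, [gens] is
    closed under inverses and no basis is chosen beforehand: taking one element
    of each pair [x], [x^-1] yields a basis. *)
Section PingPong.
Variables (G : groupType) (Y : Type) (act : G -> Y -> Y) (o : Y).
Variables (gens : set G) (branch : G -> set Y).
Hypothesis tfG : torsion_free G.
Hypothesis act1 : forall y, act 1 y = y.
Hypothesis actM : forall g h y, act (g * h) y = act g (act h y).
Hypothesis gens_neq1 : forall x, gens x -> x <> 1.
Hypothesis gensV : forall x, gens x -> gens x^-1.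
Hypothesis gens_generate : forall g, exists w : seq G,
  (forall x, x \in w -> gens x) /\ \prod_(x <- w) x = g.
Hypothesis branch_base : forall x, gens x -> ~ branch x o.
Hypothesis branch_disjoint : forall x y z,
  gens x -> gens y -> branch x z -> branch y z -> x = y.
Hypothesis branch_ping : forall x z,
  gens x -> ~ branch x^-1 z -> branch x (act x z).

(** A choice between [x] and [x^-1] that depends only on the pair; the basis
    consists of the chosen generators. *)
Let rep (x : G) : G := xget 1 [set y | y = x \/ y = x^-1].

Let repV x : rep x^-1 = rep x.
Proof.
congr xget; apply/seteqP; split=> y /=; rewrite ?invgK => -[]; by [left|right].
Qed.

Let rep_or x : rep x = x \/ rep x = x^-1.
Proof.
have : exists y, [set y | y = x \/ y = x^-1] y by exists x; left.
by move/(xgetPex 1).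
Qed.

Let X : set G := [set x | gens x /\ rep x = x].

Let letter_gens l : X l.1 -> gens (letter_val l).
Proof. by case: l => x [] [/= gens_x _]; [exact: gens_x | exact: gensV]. Qed.

Let not_involutive x : gens x -> x <> x^-1.
Proof.
move=> /gens_neq1 x1 xV; apply/x1/(@tfG _ 2) => //.
by rewrite expg2 [X in X * _]xV mulVg.
Qed.

(** Without torsion, a generator differs from its inverse, so it is the value
    of only one letter. *)
Let letter_inj l l' : X l.1 -> X l'.1 -> letter_val l = letter_val l' -> l = l'.
Proof.
have aux x y : X x -> X y -> x <> y^-1.
  move=> [gens_x sx] [gens_y sy] e; apply: (not_involutive gens_x).
  have xy : x = y by rewrite -sx e repV.
  by rewrite {2}xy.
case: l l' => x [] [y []] /= Xx Xy; rewrite /letter_val /=.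
- by move->.
- by move/(aux _ _ Xx Xy).
- by move/esym/(aux _ _ Xy Xx).
- by move/invg_inj->.
Qed.

Let letter_surj x : gens x -> exists2 l, X l.1 & letter_val l = x.
Proof.
move=> gens_x; case: (rep_or x) => sx; first by exists (x, true).
exists (x^-1, false); last by rewrite /letter_val /= invgK.
by split; [exact: gensV | rewrite repV].
Qed.

Let word_prod (w : seq (G * bool)) := \prod_(l <- w) letter_val l.

(** The value of a reduced word moves [o] into the branch of its first letter,
    so this letter can be read off from the value. By induction, the value of
    the tail moves [o] into the branch of the second letter, which is not the
    inverse of the first one and so has a branch disjoint from that of the
    inverse. *)
Let reduced_first l w : (forall k, k \in l :: w -> X k.1) ->
  reduced_word (l :: w) -> branch (letter_val l) (act (word_prod (l :: w)) o).
Proof.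
elim: w l => [|k w IH] l Xlw.
  have gens_l := letter_gens (Xlw l (mem_head _ _)).
  move=> _; rewrite /word_prod big_cons big_nil mulg1; apply: branch_ping => //.
  by apply: branch_base; exact: gensV.
rewrite /reduced_word /= => /andP[lk rw].
have Xl := Xlw l (mem_head _ _).
have Xkw j : j \in k :: w -> X j.1.
  by move=> jkw; apply: Xlw; rewrite inE jkw orbT.
have Xk := Xkw k (mem_head _ _).
rewrite /word_prod big_cons actM.
apply: branch_ping => [|branch_l]; first exact: letter_gens.
have kl : letter_val k = letter_val (l.1, ~~ l.2).
  have -> : letter_val (l.1, ~~ l.2) = (letter_val l)^-1.
    by rewrite /letter_val /=; case: l.2 => //=; rewrite invgK.
  apply: branch_disjoint (IH k Xkw rw) branch_l; first exact: letter_gens.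
  exact/gensV/letter_gens.
move: lk; rewrite (letter_inj Xk _ kl) //= eqxx /=.
by case: l.2.
Qed.

Let reduced_unique w w' :
  (forall k, k \in w -> X k.1) -> (forall k, k \in w' -> X k.1) ->
  reduced_word w -> reduced_word w' -> word_prod w = word_prod w' -> w = w'.
Proof.
have nontriv l u : (forall k, k \in l :: u -> X k.1) -> reduced_word (l :: u) ->
    word_prod (l :: u) <> 1.
  move=> Xlu rlu e; have := reduced_first Xlu rlu; rewrite e act1.
  by apply: branch_base; apply: letter_gens; exact: Xlu (mem_head _ _).
elim: w w' => [|l w IH] [|l' w'] // Xw Xw' rw rw' e.
- by case: (nontriv l' w' Xw' rw'); rewrite -e /word_prod big_nil.
- by case: (nontriv l w Xw rw); rewrite e /word_prod big_nil.
have Xl := Xw l (mem_head _ _); have Xl' := Xw' l' (mem_head _ _).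
have ll' : l = l'.
  apply: letter_inj => //.
  apply: branch_disjoint (letter_gens Xl) (letter_gens Xl') _ _.
    exact: reduced_first Xw rw.
  by rewrite e; exact: reduced_first.
move: e; rewrite -ll' /word_prod !big_cons => /mulgI e; congr cons.
apply: IH => // [k kw|k kw||].
- by apply: Xw; rewrite inE kw orbT.
- by apply: Xw'; rewrite inE kw orbT.
- exact: path_sorted rw.
- exact: path_sorted rw'.
Qed.

Let reduced_exists g : exists w : seq (G * bool),
  [/\ forall l, l \in w -> X l.1, reduced_word w & word_prod w = g].
Proof.
have [xs [gens_xs <-]] := gens_generate g.
elim: xs gens_xs => [|x xs IH] gens_xs.
  by exists [::]; rewrite /word_prod !big_nil.
have {IH} [|w [Xw rw e]] := IH.
  by move=> y yxs; apply: gens_xs; rewrite inE yxs orbT.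
have [l Xl lx] := letter_surj (gens_xs x (mem_head _ _)).
rewrite big_cons -e -lx; case: w Xw rw {e} => [|k w] Xw rw.
  exists [:: l]; split=> // [k|]; first by rewrite inE => /eqP->.
  by rewrite /word_prod !big_cons.
have [lk|nlk] := boolP ((l.1 == k.1) && (l.2 != k.2)); last first.
  exists [:: l, k & w]; split=> [j||].
  - by rewrite inE => /orP[/eqP->//|/Xw].
  - by rewrite /reduced_word /= nlk.
  - by rewrite /word_prod !big_cons.
exists w; split=> [j jw||]; first by apply: Xw; rewrite inE jw orbT.
  exact: path_sorted rw.
rewrite /word_prod big_cons; case: l k lk {Xl lx Xw rw} => x1 [] [y []] /=;
  rewrite ?andbF // andbT => /eqP->; by rewrite /letter_val /= ?mulKg ?mulVKg.
Qed.

Lemma ping_pong_free : free_group G.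
Proof.
exists X => g; have [w [Xw rw wg]] := reduced_exists g.
exists w; split=> // w' [Xw' rw' w'g]; apply: reduced_unique => //.
by rewrite wg.
Qed.

End PingPong.

(** * Half-trees and free actions on trees *)

Section HalfTrees.
Variable T : tree.
Implicit Types (u v w x y : T) (p : seq T).

Lemma path_exit (C : set T) x p : path (@adj T) x p -> C x -> ~ C (last x p) ->
  exists a b, [/\ adj a b, C a & ~ C b].
Proof.
elim: p x => [|y p IH] x //= /andP[xy yp] Cx nC.
by have [Cy|nCy] := pselect (C y); [exact: IH yp Cy nC | exists x, y].
Qed.

(** For adjacent [u] and [v], this is the component of [v] once the edge from
    [u] to [v] is removed. *)
Definition half_tree u v : set T :=
  [set w | exists p, [/\ path (@adj T) v p, last v p = w & u \notin v :: p]].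

Lemma half_treeN u v : ~ half_tree u v u.
Proof. by move=> [p [_ <-]]; rewrite mem_last. Qed.

Lemma half_tree_path u v p w : path (@adj T) v p -> u \notin v :: p ->
  w \in v :: p -> half_tree u v w.
Proof.
move=> vp uvp wvp; case/splitPl: wvp vp uvp => p1 p2 lastw.
rewrite cat_path -cat_cons mem_cat => /andP[vp1 _] /norP[uvp1 _].
by exists p1.
Qed.

(** The only way into a half-tree is its defining edge. If [x] were not [u],
    then the path avoiding [u] from [v] to [y] would extend to [x]; and if [y]
    were not [v], that path would close up through [u] to a cycle. *)
Lemma half_tree_entry u v x y : adj u v -> adj x y ->
  ~ half_tree u v x -> half_tree u v y -> x = u /\ y = v.
Proof.
move=> uv xy nx [p0 [vp0 lastp0 up0]].
have xu : x = u.
  apply: contrapT => xu; apply: nx; exists (rcons p0 x).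
  rewrite rcons_path vp0 lastp0 adj_sym xy last_rcons -rcons_cons mem_rcons inE.
  by rewrite negb_or up0 eq_sym; split=> //; rewrite andbT; apply/eqP.
split=> //; rewrite {}xu {nx} in xy.
case: (shortenP vp0) lastp0 => p vp uniqp subp lasty.
have up : u \notin v :: p.
  by apply: contra up0; rewrite !inE => /orP[->//|/subp->]; rewrite orbT.
apply: contrapT => yv; have := @tree_acyclic T [:: u, v & p].
case: p => [|z p] /= in lasty vp uniqp subp up *.
  by move: yv; rewrite -lasty.
move=> /(_ isT) /negP; apply; rewrite /ucycleb /cycle rcons_path /=.
by rewrite lasty uv (adj_sym y) xy up uniqp !andbT.
Qed.

Lemma half_tree_crossing u v x p : adj u v -> path (@adj T) x p ->
  ~ half_tree u v x -> half_tree u v (last x p) -> u \in x :: p /\ v \in p.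
Proof.
move=> uv; elim: p x => [|y p IH] x //= /andP[xy yp] nx hp.
have [hy|ny] := pselect (half_tree u v y).
  by have [-> ->] := half_tree_entry uv xy nx hy; rewrite !inE !eqxx.
by have [up vp] := IH y yp ny hp; split; rewrite inE ?up ?vp orbT.
Qed.

(** A simple path from [u] to [w] either avoids [v], or avoids [u] after its
    visit to [v]. *)
Lemma half_tree_cover u v w : adj u v ->
  half_tree u v w \/ half_tree v u w.
Proof.
move=> uv; have [p0 up0 lastp0] := tree_connected u w.
case: (shortenP up0) lastp0 => p up uniqp _ lastw.
have [vp|vp] := boolP (v \in p); last first.
  right; exists p; split=> //; rewrite inE negb_or vp andbT.
  by apply: contraTN uv => /eqP->; rewrite adj_irr.
left; case/splitPr: vp up uniqp lastw => p1 p2.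
rewrite cat_path last_cat -cat_cons cat_uniq /= => /and3P[_ _ vp2].
move=> /and3P[_ /norP[vp1 /hasPn p12] _] <-; exists p2; split=> //.
rewrite inE negb_or; apply/andP; split.
  by apply: contraNneq vp1 => ->; rewrite mem_head.
by apply/negP => /p12; rewrite mem_head.
Qed.
End HalfTrees.

Record tree_action (G : groupType) (T : tree) (act : G -> T -> T) : Prop := {
  tree_act1 : forall v, act 1 v = v;
  tree_actM : forall g h v, act (g * h) v = act g (act h v);
  tree_act_adj : forall g v w, adj (act g v) (act g w) = adj v w
}.

Section FreeAction.
Variables (G : groupType) (T : tree) (act : G -> T -> T).
Hypothesis tfG : torsion_free G.
Hypothesis actT : tree_action act.
Hypothesis act_free : forall g v, act g v = v -> g = 1.
Implicit Types (g h : G) (u v w : T).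

Let actK g v : act g^-1 (act g v) = v.
Proof. by rewrite -(tree_actM actT) mulVg (tree_act1 actT). Qed.

Let actVK g v : act g (act g^-1 v) = v.
Proof. by rewrite -(tree_actM actT) mulgV (tree_act1 actT). Qed.

Let half_tree_act g u v w :
  half_tree u v w -> half_tree (act g u) (act g v) (act g w).
Proof.
move=> [p [vp <- uvp]]; exists (map (act g) p); split.
- rewrite path_map; apply: sub_path vp => x y.
  by rewrite /= (tree_act_adj actT).
- by rewrite last_map.
- by rewrite -map_cons mem_map //; exact: can_inj (actK g).
Qed.

(** Stating connectedness through paths from [o] makes the empty set satisfy
    the condition, as needed for the union of an empty chain. *)
Let partial_domain (o : T) (D : set T) :=
  (forall g v, D v -> D (act g v) -> g = 1) /\
  (forall v, D v -> exists p,
     [/\ path (@adj T) o p, last o p = v & forall w, w \in o :: p -> D w]).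

(** A maximal partial domain meets every orbit: otherwise the vertices whose
    orbit meets it form a proper nonempty set of vertices, some edge leaves this
    set, and the far end of a translate of that edge can be added. *)
Let exists_domain (o : T) : exists D : set T,
  [/\ D o, partial_domain o D & forall v, exists g, D (act g v)].
Proof.
have [|D [PD maxD]] := @Zorn_bigcup _ (partial_domain o).
  move=> F FP Ftot; split=> [g v [A FA Av] [A' FA' A'v]|v [A FA Av]].
    have [/(_ _ Av) A'v'|/(_ _ A'v) Agv] := Ftot _ _ FA FA'.
      exact: (FP _ FA').1 A'v' A'v.
    exact: (FP _ FA).1 Av Agv.
  have [_ con] := FP _ FA; have [p [op lastp pA]] := con v Av.
  by exists p; split=> // w /pA Aw; exists A.
have Do : D o.
  apply: contrapT => nDo; apply: (maxD [set o]).
    split=> [v Dv|/(_ o erefl)//]; have [p [_ _ pD]] := PD.2 v Dv.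
    by case: nDo; apply: pD; rewrite mem_head.
  split=> [g v -> /act_free//|v ->]; exists [::]; split=> // w.
  by rewrite inE => /eqP.
exists D; split=> // v; apply: contrapT => nv.
have [p op lastp] := tree_connected o v.
have [a [b [ab [g Dga] nb]]] : exists a b,
    [/\ adj a b, exists g, D (act g a) & ~ exists g, D (act g b)].
  apply: (@path_exit _ [set a | exists g, D (act g a)] _ _ op).
    by exists 1; rewrite (tree_act1 actT).
  by rewrite lastp.
have nD h : ~ D (act h (act g b)).
  by rewrite -(tree_actM actT) => Dhg; apply: nb; exists (h * g).
apply: (maxD (D `|` [set act g b])).
  split=> [w|/(_ (act g b))]; first by left.
  by move=> /(_ (or_intror erefl)) Dgb; apply: nb; exists g.
split=> [h w [Dw|->] [Dhw|hw]|w].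
- exact: PD.1 Dhw.
- by case: (nD h^-1); rewrite -hw actK.
- by case: (nD h).
- exact: act_free hw.
move=> [Dw|->].
  have [q [oq lastq qD]] := PD.2 w Dw.
  by exists q; split=> // x /qD; left.
have [q [oq lastq qD]] := PD.2 _ Dga.
exists (rcons q (act g b)); split.
- by rewrite rcons_path oq lastq (tree_act_adj actT).
- by rewrite last_rcons.
move=> x; rewrite -rcons_cons mem_rcons inE.
by move=> /orP[/eqP->|/qD]; [right | left].
Qed.

Section Domain.
Variables (o : T) (D : set T).
Hypothesis Do : D o.
Hypothesis D_inj : forall g v, D v -> D (act g v) -> g = 1.
Hypothesis D_conn : forall v, D v -> exists p,
  [/\ path (@adj T) o p, last o p = v & forall w, w \in o :: p -> D w].
Hypothesis D_cover : forall v, exists g, D (act g v).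

Let D_path u v : D u -> D v -> exists p,
  [/\ path (@adj T) u p, last u p = v & forall w, w \in u :: p -> D w].
Proof.
move=> /D_conn[p [op <- pD]] /D_conn[q [oq lastq qD]].
have rp : path (@adj T) (last o p) (rev (belast o p)).
  by rewrite rev_path; apply: sub_path op => x y; rewrite adj_sym.
have lastr : last (last o p) (rev (belast o p)) = o.
  by case: (p) => [|x p'] //=; rewrite rev_cons last_rcons.
exists (rev (belast o p) ++ q); split.
- by rewrite cat_path rp lastr.
- by rewrite last_cat lastr.
move=> w; rewrite -cat_cons mem_cat inE mem_rev => /orP[|wq]; last first.
  by apply: qD; rewrite inE wq orbT.
by move=> wp; apply: pD; rewrite lastI mem_rcons inE.
Qed.

(** The nontrivial [x] such that some edge joins [D] to its translate by [x]. *)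
Let gluing : set G :=
  [set x | x <> 1 /\ exists u v, [/\ adj u v, D u & D (act x^-1 v)]].

(** The part of the tree beyond the edges from [D] to its translate by [x].
    There is in fact one such edge; quantifying over all of them dispenses with
    a choice of edge compatible with inversion of [x]. *)
Let branch (x : G) : set T :=
  [set w | exists u v, [/\ adj u v, D u, D (act x^-1 v) & half_tree u v w]].

(** [D] is connected and a path can enter the half-tree only through [v]. *)
Let half_tree_domain u v w :
  adj u v -> D u -> ~ D v -> half_tree u v w -> ~ D w.
Proof.
move=> uv Du nDv hw Dw; apply: nDv; have [p [up lastp pD]] := D_path Du Dw.
apply: pD; rewrite inE; apply/orP; right.
by have := half_tree_crossing uv up (@half_treeN _ u v); rewrite lastp => -[].
Qed.

Let translate_disjoint x y v : D (act x^-1 v) -> D (act y^-1 v) -> x = y.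
Proof.
move=> Dx Dy; apply/esym/invg_inj/divg1_eq; apply: D_inj Dx _.
by rewrite (tree_actM actT) invgK actVK.
Qed.

Let domain_translate x v : x <> 1 -> D (act x^-1 v) -> ~ D v.
Proof.
move=> x1 Dxv Dv; apply: x1; apply: translate_disjoint Dxv _.
by rewrite invg1 (tree_act1 actT).
Qed.

Let gluingV x : gluing x -> gluing x^-1.
Proof.
move=> [x1 [u [v [uv Du Dv]]]]; split=> [xV|].
  by apply/x1/invg_inj; rewrite invg1.
exists (act x^-1 v), (act x^-1 u); rewrite (tree_act_adj actT) adj_sym.
by rewrite invgK actVK.
Qed.

Let branch_domain x w : gluing x -> branch x w -> ~ D w.
Proof.
move=> [x1 _] [u [v [uv Du Dv]]]; apply: half_tree_domain => //.
exact: domain_translate Dv.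
Qed.

(** Suppose that the half-trees of two edges leaving [D] for different
    translates meet at [w]. A path from [v] to [w] inside the first must enter
    the second through [u'], which lies in [D], whereas the first half-tree is
    disjoint from [D]. *)
Let branch_disjoint x y w :
  gluing x -> gluing y -> branch x w -> branch y w -> x = y.
Proof.
move=> [x1 _] [y1 _] [u [v [uv Du Dv [p [vp lastp uvp]]]]].
move=> [u' [v' [uv' Du' Dv' hw']]].
have nDv := domain_translate x1 Dv; have nDv' := domain_translate y1 Dv'.
have [vv'|vv'] := eqVneq v v'.
  by apply: translate_disjoint Dv _; rewrite vv'.
have nhv : ~ half_tree u' v' v.
  move=> hv; have [q [uq lastq qD]] := D_path Du' Du.
  have [||_] :=
    @half_tree_crossing _ u' v' u' (rcons q v) uv' _ (@half_treeN _ _ _).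
  - by rewrite rcons_path uq lastq.
  - by rewrite last_rcons.
  rewrite mem_rcons inE eq_sym (negbTE vv') /= => v'q.
  by apply/nDv'/qD; rewrite inE v'q orbT.
have [|u'p _] := half_tree_crossing uv' vp nhv; first by rewrite lastp.
have := half_tree_path vp uvp u'p.
by move=> /(half_tree_domain uv Du nDv) [].
Qed.

(** Translation by [x] takes the half-tree at the [D] end of an edge from [D] to
    its translate by [x^-1], which contains the complement of
    [branch x^-1], to a half-tree beyond an edge from [D] to its translate
    by [x]. *)
Let branch_ping x w : gluing x -> ~ branch x^-1 w -> branch x (act x w).
Proof.
move=> [x1 [u [v [uv Du Dv]]]] nbw; exists u, v; split=> //.
rewrite -[u](actVK x) -[v](actVK x); apply: half_tree_act.
have vu' : adj (act x^-1 v) (act x^-1 u) by rewrite (tree_act_adj actT) adj_sym.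
have [hw|//] := half_tree_cover w vu'; case: nbw.
by exists (act x^-1 v), (act x^-1 u); rewrite invgK actVK.
Qed.

(** Consecutive vertices of a path lie in equal or adjacent translates of [D];
    the word lists the successive passages. *)
Let gluing_path v p a b : path (@adj T) v p ->
  D (act a^-1 v) -> D (act b^-1 (last v p)) ->
  exists s : seq G, (forall x, x \in s -> gluing x) /\
    \prod_(x <- s) x = a^-1 * b.
Proof.
elim: p v a => [|w p IH] v a /= => [_ Da Db|/andP[vw wp] Da Db].
  exists [::]; split=> //.
  by rewrite (translate_disjoint Da Db) mulVg big_nil.
have [c Dc] := D_cover w; rewrite -[c]invgK in Dc.
have [s [gs sE]] := IH w c^-1 wp Dc Db.
have [ac|ac] := pselect (a = c^-1); first by exists s; rewrite ac.
exists (a^-1 * c^-1 :: s); split; last first.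
  by rewrite big_cons sE invgK mulgA mulgVK.
move=> x; rewrite inE => /orP[/eqP->|/gs//]; split.
  by move=> /mulg1_eq; rewrite invgK.
exists (act a^-1 v), (act a^-1 w); rewrite (tree_act_adj actT); split=> //.
by rewrite -(tree_actM actT) invgM mulgVK.
Qed.

Let gluing_generates g : exists s : seq G,
  (forall x, x \in s -> gluing x) /\ \prod_(x <- s) x = g.
Proof.
have [p op lastp] := tree_connected o (act g o).
have [||s [gs sE]] := @gluing_path o p 1 g op.
- by rewrite invg1 (tree_act1 actT).
- by rewrite lastp actK.
by exists s; rewrite sE invg1 mul1g.
Qed.

Lemma free_of_domain : free_group G.
Proof.
apply: (@ping_pong_free G T act o gluing branch) => //.
- exact: tree_act1 actT.
- exact: tree_actM actT.
- by move=> x [].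
- by move=> x gx /(branch_domain gx) [].
Qed.

End Domain.

Theorem free_of_free_tree_action : free_group G.
Proof.
have [o _] := tree_nonempty T.
have [D [Do [D_inj D_conn] D_cover]] := exists_domain o.
exact: free_of_domain Do D_inj D_conn D_cover.
Qed.
End FreeAction.

(** * Discreteness for pointwise convergence *)

Lemma multiplicative1 (G H : groupType) (f : {multiplicative G -> H}) :
  f 1 = 1.
Proof. by apply: (@mulgI _ (f 1)); rewrite -gmulfM !mulg1. Qed.

Section DiscreteRep.
Variables (V : choiceType) (K : set (set V)).

(** The sets of automorphisms that agree with [a] on a finite set of vertices
    generate a filter that converges pointwise to [a]. *)
Lemma nbhs_aut (a : aut K) (U : set (aut K)) : nbhs a U ->
  exists s : seq V, forall b : aut K, {in s, b =1 a} -> U b.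
Proof.
pose agree (f : V -> V) (s : seq V) := [set g : V -> V | {in s, g =1 f}].
pose F : set_system (V -> V) :=
  [set W | exists s, agree (aut_fun a) s `<=` W].
have FF : Filter F.
  split=> [|A B [s sA] [t tB]|A B AB [s sA]].
  - by exists [::].
  - exists (s ++ t) => g gst; split; [apply: sA|apply: tB] => x xs;
      by apply: gst; rewrite mem_cat xs ?orbT.
  - by exists s; exact: subset_trans sA AB.
have cvgF : F --> (aut_fun a : {ptws V -> discrete_topology V}).
  apply/cvg_sup => v W [_ [[B oB <-] Bav] BW].
  by exists [:: v] => g gv; apply: BW; rewrite /= gv ?inE.
move=> [_ [[B oB <-] Bf] BU].
have [s sB] : F B by apply: cvgF; apply: open_nbhs_nbhs.
by exists s => b bs; apply: BU; exact: sB.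
Qed.

Lemma discrete_rep_base (G : groupType) (rho : {multiplicative G -> aut K}) :
  discrete_rep rho ->
  exists s : seq V, forall g, {in s, forall v, rho g v = v} -> rho g = 1.
Proof.
move=> /(_ 1) [|_ [U U1 Urho]].
  by exists 1 => //; rewrite (multiplicative1 rho).
have [s sU] := nbhs_aut U1; exists s => g gs.
have : (U `&` range rho) (rho g) by split; [exact: sU|exists g].
by rewrite Urho.
Qed.
End DiscreteRep.

(** * Elements fixing a vertex *)

(** Edges are the cells with two vertices, and automorphisms are injective. *)
Lemma tree_aut_adj (T : tree) (a : aut (tree_cells T)) v w :
  adj (a v) (a w) = adj v w.
Proof.
suff edge (b : aut (tree_cells T)) x y : adj x y -> adj (b x) (b y).
  by apply/idP/idP => [/(edge (aut_invg a))|/edge//]; rewrite /= !aut_funK.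
move=> xy; have bxy : b x <> b y.
  by move=> /(can_inj (@aut_funK _ _ b)) e; rewrite e adj_irr in xy.
have : tree_cells T (b @` [set x; y]) by apply/aut_cell; right; exists x, y.
rewrite image_setU !image_set1 => -[[z e]|[x' [y' [xy' e]]]].
  have zx : [set z] (b x) by rewrite -e; left.
  have zy : [set z] (b y) by rewrite -e; right.
  by case: bxy; rewrite zx zy.
have bx : [set x'; y'] (b x) by rewrite -e; left.
have {e} yxy : [set x'; y'] (b y) by rewrite -e; right.
case: bx yxy bxy => -> [] -> //; by rewrite // adj_sym.
Qed.

Lemma tree_aut_action (G : groupType) (T : tree)
    (rho : {multiplicative G -> aut (tree_cells T)}) :
  tree_action (fun g => rho g : T -> T).
Proof.
split=> [v|g h v|g v w]; last exact: tree_aut_adj.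
- by rewrite (multiplicative1 rho).
- by rewrite gmulfM.
Qed.

Lemma mulVg_eq1 (G : groupType) (g h : G) : g^-1 * h = 1 -> g = h.
Proof. by move=> /mulg1_eq; rewrite invgK. Qed.

Section Periods.
Variables (G : groupType) (T : tree) (act : G -> T -> T).
Hypothesis actT : tree_action act.

Lemma fix_expg g v n : act g v = v -> act (g ^+ n) v = v.
Proof.
move=> gv; elim: n => [|n IH]; first by rewrite expg0 (tree_act1 actT).
by rewrite expgS (tree_actM actT) IH.
Qed.

Lemma act_eq_fix g h v : act g v = act h v -> act (g^-1 * h) v = v.
Proof.
move=> e; rewrite (tree_actM actT) -e -(tree_actM actT).
by rewrite mulVg (tree_act1 actT).
Qed.

Hypothesis bvT : bounded_valence T.

(** All translates of [w] by powers of [g] are among the finitely many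
    neighbours of [v], so two of them coincide. *)
Let period_adj g v w : act g v = v -> adj v w ->
  exists2 n, (0 < n)%N & act (g ^+ n) w = w.
Proof.
move=> gv vw; have [N /(_ v) vN] := bvT.
have /finite_seqP[s sE] := card_le_finite vN (finite_II N).
have nbr n : act (g ^+ n) w \in s.
  have : [set` s] (act (g ^+ n) w); last by [].
  by rewrite -sE /= -[X in adj X _](fix_expg n gv) (tree_act_adj actT).
apply: contrapT => aper; suff : ((size s).+1 <= size s)%N by rewrite ltnn.
rewrite -[(size s).+1](size_mkseq (fun n => act (g ^+ n) w)).
rewrite uniq_leq_size //; last first.
  by move=> _ /mapP[n _ ->].
have lt_neq m n : (m < n)%N -> act (g ^+ m) w <> act (g ^+ n) w.
  move=> mn e; apply: aper; exists (n - m)%N; first by rewrite subn_gt0.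
  rewrite -[RHS](tree_act1 actT) -(mulVg (g ^+ m)) (tree_actM actT) e.
  by rewrite -(tree_actM actT) -{2}(subnKC (ltnW mn)) expgnDr mulKg.
rewrite mkseq_uniq // => m n e.
by case: (ltngtP m n) => // /lt_neq; rewrite e.
Qed.

Lemma elliptic_period g v w : act g v = v ->
  exists2 n, (0 < n)%N & act (g ^+ n) w = w.
Proof.
have [p + <-] := tree_connected v w; elim: p v g => [|x p IH] v g /=.
  by move=> _ gv; exists 1%N.
move=> /andP[vx xp] gv; have [m m0 gmx] := period_adj gv vx.
have [n n0 gn] := IH x (g ^+ m) xp gmx.
by exists (m * n)%N; rewrite ?muln_gt0 ?m0 // expgnA.
Qed.

Lemma elliptic_period_seq g v (s : seq T) : act g v = v ->
  exists2 n, (0 < n)%N & {in s, forall w, act (g ^+ n) w = w}.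
Proof.
move=> gv; elim: s => [|w s [n n0 IH]]; first by exists 1%N.
have [m m0 gw] := elliptic_period w gv.
exists (m * n)%N => [|x]; first by rewrite muln_gt0 m0.
rewrite inE => /orP[/eqP->|xs]; first by rewrite expgnA fix_expg.
by rewrite mulnC expgnA fix_expg ?IH.
Qed.
End Periods.

(** * Discrete actions on a product of two trees *)

(** An element that fixes a vertex has a positive power that fixes the finite
    set given by discreteness, so the action is free on vertices. *)
Lemma discrete_tree_rep_free (G : groupType) (T : tree)
    (rho : {multiplicative G -> aut (tree_cells T)}) :
  torsion_free G -> bounded_valence T -> injective rho -> discrete_rep rho ->
  free_group G.
Proof.
move=> tfG bvT rho_inj /discrete_rep_base[s base].
have actT := tree_aut_action rho.
apply: (free_of_free_tree_action tfG actT) => g v gv.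
have [n n0 gn] := elliptic_period_seq actT bvT s gv.
by apply: (tfG g n) => //; apply: rho_inj; rewrite multiplicative1 base.
Qed.

(** The second action is free on vertices: if [g] fixes [v], a power [a] of [g]
    fixes both [v] and [h v], so it commutes with [h]; a relation between
    powers of [a] and [h], applied to [v], then forces [a = 1]. *)
Lemma free_of_kernel (G : groupType) (T1 T2 : tree)
    (act1 : G -> T1 -> T1) (act2 : G -> T2 -> T2) (h : G) :
  torsion_free G -> hyperbolic_group G ->
  tree_action act1 -> tree_action act2 -> bounded_valence T2 ->
  (forall g v1 v2, act1 g v1 = v1 -> act2 g v2 = v2 -> g = 1) ->
  (forall v, act1 h v = v) -> h <> 1 ->
  free_group G.
Proof.
move=> tfG hypG act1T act2T bvT act_free h_ker h1.
have [o _] := tree_nonempty T1.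
apply: (free_of_free_tree_action tfG act2T) => g v gv.
have [n n0 ghv] := elliptic_period act2T bvT (act2 h v) gv.
set a := g ^+ n in ghv.
have av : act2 a v = v by apply: fix_expg.
have ah : commute a h.
  apply/mulVg_eq1/(act_free _ o v).
    by apply: (act_eq_fix act1T); rewrite !(tree_actM act1T) !h_ker.
  by apply: (act_eq_fix act2T); rewrite !(tree_actM act2T) av.
have [i [j [i' [j' [ne e]]]]] := hyperbolic_commute_dependent hypG ah.
(* Since a fixes v, the relation says that h ^+ j and h ^+ j' agree at v; they
   also agree on the first tree, where h acts trivially. *)
have hj k m : act2 (a ^+ m * h ^+ k) v = act2 (h ^+ k) v.
  by rewrite (commuteX2 _ _ ah) (tree_actM act2T) (fix_expg act2T _ av).
have {hj} hjj' : act2 (h ^+ j) v = act2 (h ^+ j') v by rewrite -(hj j i) e hj.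
have {hjj'} hh : h ^+ j = h ^+ j'.
  apply/mulVg_eq1/(act_free _ o v); last exact: act_eq_fix.
  by apply: (act_eq_fix act1T); rewrite !(fix_expg act1T) // h_ker.
have jj' : j = j' by case: (torsion_free_inj_exp tfG hh).
move: e; rewrite hh => /mulIg /(torsion_free_inj_exp tfG)[ii'|a1].
  by case: ne; rewrite ii' jj'.
exact: tfG n0 a1.
Qed.

Theorem theorem6 (Gamma : groupType) (T1 T2 : tree)
    (rho : {multiplicative Gamma -> prod_tree_aut T1 T2})
    (rho1 : {multiplicative Gamma -> tree_aut T1})
    (rho2 : {multiplicative Gamma -> tree_aut T2}) :
  torsion_free Gamma -> hyperbolic_group Gamma ->
  bounded_valence T1 -> bounded_valence T2 ->
  discrete_rep rho -> injective rho ->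
  (forall g : Gamma, rho g = aut_prod (rho1 g) (rho2 g)) ->
  free_group Gamma \/
  ((injective rho1 /\ ~ discrete_rep rho1) /\
   (injective rho2 /\ ~ discrete_rep rho2)).
Proof.
move=> tfG hypG bv1 bv2 /discrete_rep_base[s base] rho_inj rhoE.
have act1T := tree_aut_action rho1; have act2T := tree_aut_action rho2.
have act_free g v1 v2 : rho1 g v1 = v1 -> rho2 g v2 = v2 -> g = 1.
  move=> gv1 gv2.
  have [m m0 gm] := elliptic_period_seq act1T bv1 [seq p.1 | p <- s] gv1.
  have [n n0 gn] := elliptic_period_seq act2T bv2 [seq p.2 | p <- s] gv2.
  apply: (tfG g (m * n)%N); first by rewrite muln_gt0 m0.
  apply: rho_inj; rewrite multiplicative1; apply: base => p ps.
  rewrite rhoE [RHS]surjective_pairing; congr pair => /=.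
    by rewrite expgnA (fix_expg act1T) // gm // map_f.
  by rewrite mulnC expgnA (fix_expg act2T) // gn // map_f.
have [?|not_free] := pselect (free_group Gamma); [by left | right].
have inj T (f : {multiplicative Gamma -> tree_aut T}) :
    (forall h, (forall v, f h v = v) -> h = 1) -> injective f.
  move=> ker1 g h e; apply/mulVg_eq1/ker1 => v.
  by apply: (act_eq_fix (tree_aut_action f)); rewrite e.
have inj1 : injective rho1.
  apply: inj => h h_ker; apply: contrapT => h1; apply: not_free.
  exact: free_of_kernel act1T act2T bv2 act_free h_ker h1.
have inj2 : injective rho2.
  apply: inj => h h_ker; apply: contrapT => h1; apply: not_free.
  apply: free_of_kernel act2T act1T bv1 _ h_ker h1 => // g v2 v1 gv2 gv1.
  exact: act_free gv1 gv2.
split; split=> // disc; apply: not_free.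
  exact: discrete_tree_rep_free disc.
exact: discrete_tree_rep_free disc.
Qed.
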